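(* Suppose $T$ is a tensor and $T_1,\dots,T_k$ are tensors with $T=T_1+\dots+T_k$. Then $\tilde S(T)\le\sum_{i=1}^k\mu(T_i)^{1/3}$.
   Context: Tensors over a field $\mathbb{F}$; a tensor over finite variable sets $X,Y,Z$ is a trilinear form $\sum\alpha_{xyz}xyz$, minimal over $X,Y,Z$ if every variable appears in some term with nonzero coefficient. The measure $\mu(T)=|X|\cdot|Y|\cdot|Z|$ where $X,Y,Z$ are the sets over which $T$ is minimal. Tensor powers $T^{\otimes n}$ are over $X^n,Y^n,Z^n$ with coordinatewise-multiplied coefficients. $T$ has x-rank 1 if $T=(\sum\alpha_xx)\otimes(\sum\beta_{yz}yz)$; $S_x(T)$ is the least number of x-rank-1 tensors summing to $T$; $S_y,S_z$ analogously; $S(T)=\min\{S_x(T_X)+S_y(T_Y)+S_z(T_Z):T=T_X+T_Y+T_Z\}$; $\tilde S(T)=\limsup_nS(T^{\otimes n})^{1/n}$. *)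

(* Defs.v *)
From HB Require Import structures.
From mathcomp Require Import all_boot all_order all_algebra.
From mathcomp Require Import all_classical all_reals all_analysis.

Set Implicit Arguments.
Unset Strict Implicit.
Unset Printing Implicit Defensive.

Import Order.TTheory GRing.Theory Num.Theory.

Local Open Scope ring_scope.

(* The trilinear form \sum alpha_(x,y,z) xyz, given by its coefficients.  A
   tensor over subsets of X, Y, Z is one whose coefficients vanish outside of
   them, so tensors with different variable sets can be added. *)
Notation tensor F X Y Z := {ffun (X * Y * Z)%type -> F}.

Section Tensors.
Variable F : fieldType.

Section FixedVariables.
Variables X Y Z : finType.
Implicit Types T : tensor F X Y Z.

Definition vars_x T : {set X} := [set x | [exists y, exists z, T (x, y, z) != 0]].
Definition vars_y T : {set Y} := [set y | [exists x, exists z, T (x, y, z) != 0]].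
Definition vars_z T : {set Z} := [set z | [exists x, exists y, T (x, y, z) != 0]].

Definition minimal_over T (A : {set X}) (B : {set Y}) (C : {set Z}) : Prop :=
  [/\ forall x y z, T (x, y, z) != 0 -> [/\ x \in A, y \in B & z \in C],
      forall x, x \in A -> exists y z, T (x, y, z) != 0,
      forall y, y \in B -> exists x z, T (x, y, z) != 0
    & forall z, z \in C -> exists x y, T (x, y, z) != 0].

Lemma minimal_overP T A B C :
  minimal_over T A B C <-> [/\ A = vars_x T, B = vars_y T & C = vars_z T].
Proof.
split=> [[sub hA hB hC] | [-> -> ->]].
  split; apply/setP => u; rewrite inE; apply/idP/idP.
  - move=> /hA [y [z nz]].
    by apply/existsP; exists y; apply/existsP; exists z.
  - by move=> /existsP [y /existsP [z /sub []]].
  - move=> /hB [x [z nz]].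
    by apply/existsP; exists x; apply/existsP; exists z.
  - by move=> /existsP [x /existsP [z /sub []]].
  - move=> /hC [x [y nz]].
    by apply/existsP; exists x; apply/existsP; exists y.
  - by move=> /existsP [x /existsP [y /sub []]].
split=> [x y z nz | x | y | z].
- split; rewrite inE; apply/existsP.
  + by exists y; apply/existsP; exists z.
  + by exists x; apply/existsP; exists z.
  + by exists x; apply/existsP; exists y.
- by rewrite inE => /existsP [y /existsP [z nz]]; exists y, z.
- by rewrite inE => /existsP [x /existsP [z nz]]; exists x, z.
- by rewrite inE => /existsP [x /existsP [y nz]]; exists x, y.
Qed.

Definition mu T : nat := (#|vars_x T| * #|vars_y T| * #|vars_z T|)%N.

Lemma mu_minimal T A B C :
  minimal_over T A B C -> mu T = (#|A| * #|B| * #|C|)%N.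
Proof. by move=> /minimal_overP [-> -> ->]. Qed.

(* The zero tensor satisfies these predicates; this does not change the least
   number of summands below, since 0 is also the empty sum. *)
Definition x_rank1 T : Prop :=
  exists (a : {ffun X -> F}) (b : {ffun Y * Z -> F}),
    forall x y z, T (x, y, z) = a x * b (y, z).
Definition y_rank1 T : Prop :=
  exists (a : {ffun Y -> F}) (b : {ffun X * Z -> F}),
    forall x y z, T (x, y, z) = a y * b (x, z).
Definition z_rank1 T : Prop :=
  exists (a : {ffun Z -> F}) (b : {ffun X * Y -> F}),
    forall x y z, T (x, y, z) = a z * b (x, y).

Definition sum_of (P : tensor F X Y Z -> Prop) T (r : nat) : Prop :=
  exists t : 'I_r -> tensor F X Y Z,
    (forall i, P (t i)) /\ T = \sum_(i < r) t i.

Lemma sum_of_x_rank1_ex T : exists r, `[< sum_of x_rank1 T r >].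
Proof.
exists #|X|; apply/asboolP.
exists (fun i => [ffun p => (p.1.1 == enum_val i)%:R * T p]); split.
  move=> i; exists [ffun x => (x == enum_val i)%:R].
  exists [ffun q => T (enum_val i, q.1, q.2)] => x y z.
  by rewrite !ffunE /=; case: eqP => [->|_] //; rewrite !mul0r.
apply/ffunP => -[[x y] z]; rewrite sum_ffunE (bigD1 (enum_rank x)) //=.
rewrite ffunE /= enum_rankK eqxx mul1r big1 ?addr0 // => i ne.
rewrite ffunE /=; case: eqP => [e|_]; last by rewrite mul0r.
by rewrite e enum_valK eqxx in ne.
Qed.

Lemma sum_of_y_rank1_ex T : exists r, `[< sum_of y_rank1 T r >].
Proof.
exists #|Y|; apply/asboolP.
exists (fun i => [ffun p => (p.1.2 == enum_val i)%:R * T p]); split.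
  move=> i; exists [ffun y => (y == enum_val i)%:R].
  exists [ffun q => T (q.1, enum_val i, q.2)] => x y z.
  by rewrite !ffunE /=; case: eqP => [->|_] //; rewrite !mul0r.
apply/ffunP => -[[x y] z]; rewrite sum_ffunE (bigD1 (enum_rank y)) //=.
rewrite ffunE /= enum_rankK eqxx mul1r big1 ?addr0 // => i ne.
rewrite ffunE /=; case: eqP => [e|_]; last by rewrite mul0r.
by rewrite e enum_valK eqxx in ne.
Qed.

Lemma sum_of_z_rank1_ex T : exists r, `[< sum_of z_rank1 T r >].
Proof.
exists #|Z|; apply/asboolP.
exists (fun i => [ffun p => (p.2 == enum_val i)%:R * T p]); split.
  move=> i; exists [ffun z => (z == enum_val i)%:R].
  exists [ffun q => T (q.1, q.2, enum_val i)] => x y z.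
  by rewrite !ffunE /=; case: eqP => [->|_] //; rewrite !mul0r.
apply/ffunP => -[[x y] z]; rewrite sum_ffunE (bigD1 (enum_rank z)) //=.
rewrite ffunE /= enum_rankK eqxx mul1r big1 ?addr0 // => i ne.
rewrite ffunE /=; case: eqP => [e|_]; last by rewrite mul0r.
by rewrite e enum_valK eqxx in ne.
Qed.

Definition S_x T : nat := ex_minn (sum_of_x_rank1_ex T).
Definition S_y T : nat := ex_minn (sum_of_y_rank1_ex T).
Definition S_z T : nat := ex_minn (sum_of_z_rank1_ex T).

Definition slice_split T (r : nat) : Prop :=
  exists TX TY TZ : tensor F X Y Z,
    T = TX + TY + TZ /\ r = (S_x TX + S_y TY + S_z TZ)%N.

Lemma slice_split_ex T : exists r, `[< slice_split T r >].
Proof.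
exists (S_x T + S_y 0%R + S_z 0%R)%N; apply/asboolP.
by exists T, 0, 0; rewrite !addr0.
Qed.

Definition slice_rank T : nat := ex_minn (slice_split_ex T).

(* The variable set X^n is {ffun 'I_n -> X}. *)
Definition tensor_power T (n : nat) :
    tensor F {ffun 'I_n -> X} {ffun 'I_n -> Y} {ffun 'I_n -> Z} :=
  [ffun p : {ffun 'I_n -> X} * {ffun 'I_n -> Y} * {ffun 'I_n -> Z} =>
     \prod_(i < n) T (p.1.1 i, p.1.2 i, p.2 i)].

End FixedVariables.

(* The limsup is taken in the extended reals, so that it is defined without a
   boundedness proof; the n = 0 term (where 0^-1 = 0) does not affect it. *)
Definition asymptotic_slice_rank (R : realType) (X Y Z : finType)
    (T : tensor F X Y Z) : \bar R :=
  limn_esup (fun n : nat =>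
    (((slice_rank (tensor_power T n))%:R : R) `^ (n%:R)^-1)%:E).

End Tensors.

(* Main.v *)
(* Expanding T^(⊗n) over the words w in [k]^n writes it as a sum of the k^n
   products T_(w_1) ⊗ ... ⊗ T_(w_n).  Slicing such a product along its smallest
   variable set gives slice rank at most the cube root of its measure, and the
   measure is submultiplicative; so by subadditivity S(T^(⊗n)) is at most
   \sum_w \prod_j mu(T_(w_j))^(1/3) = (\sum_i mu(T_i)^(1/3))^n. *)
Require Import Defs.
From HB Require Import structures.
From mathcomp Require Import all_boot all_order all_algebra.
From mathcomp Require Import all_classical all_reals all_analysis.

Set Implicit Arguments.
Unset Strict Implicit.
Unset Printing Implicit Defensive.

Import Order.TTheory GRing.Theory Num.Theory.

Local Open Scope ring_scope.

(** * Real powers of products, product sets and upper limits *)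

Lemma powR_natr_prod (R : realType) (I : finType) (a : R) (m : I -> nat) :
  (\prod_i m i)%:R `^ a = \prod_i (m i)%:R `^ a.
Proof.
apply: (big_ind2 (fun p (x : R) => p%:R `^ a = x)) => [|p _ q _ <- <-|//].
  by rewrite powR1.
by rewrite natrM powRM.
Qed.

Lemma card_family_prod (aT rT : finType) (A : aT -> {set rT}) :
  #|family (fun i => mem (A i))| = (\prod_i #|A i|)%N.
Proof. by rewrite card_family foldrE big_image. Qed.

(** The upper limit is the infimum of the suprema of the tails, and the tail starting at [N] already
    has supremum at most [M]. *)
Lemma limn_esup_le (R : realType) (u : (\bar R)^nat) (M : \bar R) (N : nat) :
  (forall n, (N <= n)%N -> (u n <= M)%E) -> (limn_esup u <= M)%E.
Proof.
move=> le_uM; rewrite limn_esup_lim (cvg_lim _ (cvg_esups_inf (u := u))) //.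
apply: le_trans (ereal_inf_lbound _) _; first by exists N.
by apply: ge_ereal_sup => _ [n /= le_Nn <-]; exact: le_uM.
Qed.

(** * Subadditivity of slice rank and its bound by the measure *)

Section SliceRank.
Variables (F : fieldType) (X Y Z : finType).
Implicit Types T U : tensor F X Y Z.

Lemma sum_of_add (P : tensor F X Y Z -> Prop) T U r s :
  sum_of P T r -> sum_of P U s -> sum_of P (T + U) (r + s).
Proof.
move=> [t [Pt ->]] [u [Pu ->]].
exists (fun i => match fintype.split i with inl j => t j | inr j => u j end); split.
  by move=> i; case: (fintype.split i).
rewrite big_split_ord /=; congr (_ + _); apply: eq_bigr => i _.
  by rewrite -[lshift s i]/(unsplit (inl i)) unsplitK.
by rewrite -[rshift r i]/(unsplit (inr i)) unsplitK.
Qed.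

Lemma sum_of_0 (P : tensor F X Y Z -> Prop) : sum_of P 0 0.
Proof. by exists (fun=> 0); split=> [[]|]; rewrite ?big_ord0. Qed.

Lemma S_xP T : sum_of (@x_rank1 F X Y Z) T (S_x T).
Proof. by rewrite /S_x; case: ex_minnP => r /asboolP. Qed.

Lemma S_yP T : sum_of (@y_rank1 F X Y Z) T (S_y T).
Proof. by rewrite /S_y; case: ex_minnP => r /asboolP. Qed.

Lemma S_zP T : sum_of (@z_rank1 F X Y Z) T (S_z T).
Proof. by rewrite /S_z; case: ex_minnP => r /asboolP. Qed.

Lemma S_x_le T r : sum_of (@x_rank1 F X Y Z) T r -> (S_x T <= r)%N.
Proof. by rewrite /S_x; case: ex_minnP => m _ le_m /asboolP/le_m. Qed.

Lemma S_y_le T r : sum_of (@y_rank1 F X Y Z) T r -> (S_y T <= r)%N.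
Proof. by rewrite /S_y; case: ex_minnP => m _ le_m /asboolP/le_m. Qed.

Lemma S_z_le T r : sum_of (@z_rank1 F X Y Z) T r -> (S_z T <= r)%N.
Proof. by rewrite /S_z; case: ex_minnP => m _ le_m /asboolP/le_m. Qed.

Lemma S_x0 : S_x (0 : tensor F X Y Z) = 0%N.
Proof. by apply/eqP; rewrite -leqn0; exact/S_x_le/sum_of_0. Qed.

Lemma S_y0 : S_y (0 : tensor F X Y Z) = 0%N.
Proof. by apply/eqP; rewrite -leqn0; exact/S_y_le/sum_of_0. Qed.

Lemma S_z0 : S_z (0 : tensor F X Y Z) = 0%N.
Proof. by apply/eqP; rewrite -leqn0; exact/S_z_le/sum_of_0. Qed.

Lemma slice_rank_le (TX TY TZ : tensor F X Y Z) :
  (slice_rank (TX + TY + TZ)%R <= S_x TX + S_y TY + S_z TZ)%N.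
Proof.
rewrite /slice_rank; case: ex_minnP => m _; apply; apply/asboolP.
by exists TX, TY, TZ.
Qed.

Lemma slice_rankP T : slice_split T (slice_rank T).
Proof. by rewrite /slice_rank; case: ex_minnP => r /asboolP. Qed.

Lemma slice_rank0 : slice_rank (0 : tensor F X Y Z) = 0%N.
Proof.
by have := slice_rank_le 0 0 0; rewrite S_x0 S_y0 S_z0 !addr0 leqn0 => /eqP.
Qed.

(** Optimal splittings of [T] and [U] are added componentwise; in each direction, concatenating two
    rank-1 decompositions gives one of the sum. *)
Lemma slice_rank_add T U : (slice_rank (T + U)%R <= slice_rank T + slice_rank U)%N.
Proof.
have [TX [TY [TZ [eT ->]]]] := slice_rankP T.
have [UX [UY [UZ [eU ->]]]] := slice_rankP U.
have -> : T + U = (TX + UX) + (TY + UY) + (TZ + UZ).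
  by rewrite eT eU addrACA (addrACA TX).
rewrite addnACA (addnACA (S_x TX)); apply: leq_trans (slice_rank_le _ _ _) _.
apply: leq_add; first apply: leq_add.
- by apply: S_x_le; apply: sum_of_add; exact: S_xP.
- by apply: S_y_le; apply: sum_of_add; exact: S_yP.
- by apply: S_z_le; apply: sum_of_add; exact: S_zP.
Qed.

Lemma slice_rank_sum (I : finType) (t : I -> tensor F X Y Z) :
  (slice_rank (\sum_i t i)%R <= \sum_i slice_rank (t i))%N.
Proof.
apply: (big_ind2 (fun U r => slice_rank U <= r)%N) => //.
  by rewrite slice_rank0.
by move=> U r V s leU leV; exact: leq_trans (slice_rank_add _ _) (leq_add _ _).
Qed.

(** Cut [T] into the slices at a fixed [x] in [A]: each is the indicator of that [x] times a form in
    the other two variables. The next two lemmas do the same in the other directions. *)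
Lemma S_x_support T (A : {set X}) :
  (forall x y z, T (x, y, z) != 0 -> x \in A) -> (S_x T <= #|A|)%N.
Proof.
move=> supp; apply: S_x_le.
exists (fun i => [ffun p => (p.1.1 == enum_val i)%:R * T p]); split.
  move=> i; exists [ffun x => (x == enum_val i)%:R].
  exists [ffun q => T (enum_val i, q.1, q.2)] => x y z.
  by rewrite !ffunE /=; case: eqP => [->|_] //; rewrite !mul0r.
apply/ffunP => -[[x y] z]; rewrite sum_ffunE.
under eq_bigr do rewrite ffunE /=.
(* The coefficient factors out, leaving a sum of indicators over [A]. That sum is 1 when [x] is in
   [A], which holds wherever the coefficient is nonzero. *)
rewrite -mulr_suml -(big_enum_val (fun a => (x == a)%:R)) /=.
have [->|/supp xA] := eqVneq (T (x, y, z)) 0; first by rewrite mulr0.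
by rewrite (bigD1 x) //= eqxx big1 ?addr0 ?mul1r // => a /andP[_ /negPf];
  rewrite eq_sym => ->.
Qed.

Lemma S_y_support T (B : {set Y}) :
  (forall x y z, T (x, y, z) != 0 -> y \in B) -> (S_y T <= #|B|)%N.
Proof.
move=> supp; apply: S_y_le.
exists (fun i => [ffun p => (p.1.2 == enum_val i)%:R * T p]); split.
  move=> i; exists [ffun y => (y == enum_val i)%:R].
  exists [ffun q => T (q.1, enum_val i, q.2)] => x y z.
  by rewrite !ffunE /=; case: eqP => [->|_] //; rewrite !mul0r.
apply/ffunP => -[[x y] z]; rewrite sum_ffunE.
under eq_bigr do rewrite ffunE /=.
rewrite -mulr_suml -(big_enum_val (fun b => (y == b)%:R)) /=.
have [->|/supp yB] := eqVneq (T (x, y, z)) 0; first by rewrite mulr0.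
by rewrite (bigD1 y) //= eqxx big1 ?addr0 ?mul1r // => b /andP[_ /negPf];
  rewrite eq_sym => ->.
Qed.

Lemma S_z_support T (C : {set Z}) :
  (forall x y z, T (x, y, z) != 0 -> z \in C) -> (S_z T <= #|C|)%N.
Proof.
move=> supp; apply: S_z_le.
exists (fun i => [ffun p => (p.2 == enum_val i)%:R * T p]); split.
  move=> i; exists [ffun z => (z == enum_val i)%:R].
  exists [ffun q => T (q.1, q.2, enum_val i)] => x y z.
  by rewrite !ffunE /=; case: eqP => [->|_] //; rewrite !mul0r.
apply/ffunP => -[[x y] z]; rewrite sum_ffunE.
under eq_bigr do rewrite ffunE /=.
rewrite -mulr_suml -(big_enum_val (fun c => (z == c)%:R)) /=.
have [->|/supp zC] := eqVneq (T (x, y, z)) 0; first by rewrite mulr0.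
by rewrite (bigD1 z) //= eqxx big1 ?addr0 ?mul1r // => c /andP[_ /negPf];
  rewrite eq_sym => ->.
Qed.

Lemma vars_supp T x y z :
  T (x, y, z) != 0 -> [/\ x \in vars_x T, y \in vars_y T & z \in vars_z T].
Proof.
have [supp _ _ _] : minimal_over T (vars_x T) (vars_y T) (vars_z T).
  exact/minimal_overP.
exact: supp.
Qed.

(** Putting all of [T] into one of the three parts bounds the slice rank by each of the three
    variable counts. Multiplying these bounds gives the cube, with no need to know which count is
    smallest. *)
Lemma slice_rank_exp3_le_mu T : (slice_rank T ^ 3 <= mu T)%N.
Proof.
rewrite !expnSr expn0 mul1n /mu !leq_mul //.
- have := slice_rank_le T 0 0; rewrite S_y0 S_z0 !addr0 !addn0 => /leq_trans; apply.
  by apply: S_x_support => x y z /vars_supp[].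
- have := slice_rank_le 0 T 0; rewrite S_x0 S_z0 addr0 add0r addn0 => /leq_trans; apply.
  by apply: S_y_support => x y z /vars_supp[].
- have := slice_rank_le 0 0 T; rewrite S_x0 S_y0 !add0r => /leq_trans; apply.
  by apply: S_z_support => x y z /vars_supp[].
Qed.

Lemma slice_rank_le_mu (R : realType) T :
  ((slice_rank T)%:R : R) <= (mu T)%:R `^ 3^-1.
Proof.
have -> : ((slice_rank T)%:R : R) = ((slice_rank T ^ 3)%:R : R) `^ 3^-1.
  by rewrite natrX -powR_mulrn // -powRrM divff ?powRr1 // pnatr_eq0.
by apply: ge0_ler_powR; rewrite ?nnegrE // ler_nat slice_rank_exp3_le_mu.
Qed.

End SliceRank.

(** * Products of different tensors and the expansion of a power of a sum *)

Section TensorProduct.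
Variables (F : fieldType) (X Y Z : finType) (n : nat).
Implicit Types t : 'I_n -> tensor F X Y Z.

(** A variant of [tensor_power] with its own factor in each coordinate, since the terms of the
    expanded power mix different [T_ i]. *)
Definition tensor_prod t :
    tensor F {ffun 'I_n -> X} {ffun 'I_n -> Y} {ffun 'I_n -> Z} :=
  [ffun p : {ffun 'I_n -> X} * {ffun 'I_n -> Y} * {ffun 'I_n -> Z} =>
     \prod_(i < n) t i (p.1.1 i, p.1.2 i, p.2 i)].

(** A nonzero coefficient of the product has only nonzero factors, so each coordinate of a variable
    occurring in it occurs in the corresponding factor. Each variable set thus lies in a product
    set. *)
Lemma mu_tensor_prod t : (mu (tensor_prod t) <= \prod_(i < n) mu (t i))%N.
Proof.
have supp x y z : tensor_prod t (x, y, z) != 0 ->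
    forall i, t i (x i, y i, z i) != 0.
  by rewrite ffunE /= => /prodf_neq0 nz i; exact: nz.
rewrite /mu !big_split /=; rewrite !leq_mul //.
- rewrite -(card_family_prod (fun i => vars_x (t i))); apply/subset_leq_card.
  apply/fintype.subsetP => x; rewrite inE => /existsP[y /existsP[z /supp nz]].
  by apply/familyP => i; have [] := vars_supp (nz i).
- rewrite -(card_family_prod (fun i => vars_y (t i))); apply/subset_leq_card.
  apply/fintype.subsetP => y; rewrite inE => /existsP[x /existsP[z /supp nz]].
  by apply/familyP => i; have [] := vars_supp (nz i).
- rewrite -(card_family_prod (fun i => vars_z (t i))); apply/subset_leq_card.
  apply/fintype.subsetP => z; rewrite inE => /existsP[x /existsP[y /supp nz]].
  by apply/familyP => i; have [] := vars_supp (nz i).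
Qed.

Lemma tensor_power_sum k (T_ : 'I_k -> tensor F X Y Z) :
  tensor_power (\sum_(i < k) T_ i) n =
  \sum_(w : {ffun 'I_n -> 'I_k}) tensor_prod (fun j => T_ (w j)).
Proof.
apply/ffunP => p; rewrite ffunE sum_ffunE.
under eq_bigr do rewrite sum_ffunE.
by rewrite bigA_distr_bigA; apply: eq_bigr => w _; rewrite ffunE.
Qed.

Lemma slice_rank_tensor_power_sum (R : realType) k (T_ : 'I_k -> tensor F X Y Z) :
  ((slice_rank (tensor_power (\sum_(i < k) T_ i) n))%:R : R) <=
  (\sum_(i < k) (mu (T_ i))%:R `^ 3^-1) ^+ n.
Proof.
(* The right-hand side is written as a product of [n] equal sums and distributed, so that both sides
   run over the same words [w] and can be compared term by term. *)
rewrite tensor_power_sum -[X in _ ^+ X]card_ord -prodr_const bigA_distr_bigA /=.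
have := slice_rank_sum (fun w : {ffun 'I_n -> 'I_k} => tensor_prod (fun j => T_ (w j))).
rewrite -(ler_nat R) natr_sum => /le_trans; apply.
apply: ler_sum => w _; apply: le_trans (slice_rank_le_mu R _) _.
rewrite -(powR_natr_prod _ (fun j => mu (T_ (w j)))).
by apply: ge0_ler_powR; rewrite ?nnegrE // ler_nat mu_tensor_prod.
Qed.

End TensorProduct.

Theorem theorem4p2 (R : realType) (F : fieldType) (X Y Z : finType)
    (T : tensor F X Y Z) (k : nat) (T_ : 'I_k -> tensor F X Y Z)
    (hT : T = \sum_(i < k) T_ i) :
  (asymptotic_slice_rank R T <= (\sum_(i < k) ((mu (T_ i))%:R : R) `^ 3^-1)%:E)%E.
Proof.
have sum_ge0 : 0 <= \sum_(i < k) (mu (T_ i))%:R `^ 3^-1 :> R.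
  by apply: sumr_ge0 => i _; exact: powR_ge0.
(* Starting at 1 matters: at [n = 0] the exponent is 0 and the term equals 1, while the bound may be
   0, for instance when [k = 0]. *)
apply: (@limn_esup_le _ _ _ 1) => n n_gt0; rewrite lee_fin hT.
have := slice_rank_tensor_power_sum n R T_.
move/(ge0_ler_powR (r := n%:R^-1)) => /(_ _ _ _) le_root.
apply: le_trans (le_root _ _ _) _; rewrite ?nnegrE ?exprn_ge0 ?invr_ge0 //.
(* The [n]-th root of the [n]-th power is the sum itself, as [n] is nonzero. *)
by rewrite -powR_mulrn // -powRrM divff ?powRr1 // pnatr_eq0 -lt0n.
Qed.
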